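(* Let $V$ be a finite-dimensional $\mathfrak{W}_q$-module. The following are equivalent: (i) $V$ is completely reducible; (ii) $K_1$ is diagonalizable on $V$; (iii) $K_2$ is diagonalizable on $V$; (iv) $I$ is diagonalizable on $V$.
   Context: Throughout, $q$ is a nonzero complex number that is not a root of unity; $[x,y]=xy-yx$ and $[x,y]_q=qxy-q^{-1}yx$. $\mathfrak{W}_q$ is the algebra over $\mathbb C$ generated by $E_1,E_2,F_1,F_2,K_1^{\pm1},K_2^{\pm1},I^{\pm1}$ subject to: $I$ is central; $II^{-1}=I^{-1}I=1$, $K_1K_1^{-1}=K_1^{-1}K_1=1$, $K_2K_2^{-1}=K_2^{-1}K_2=1$; $[K_1,E_2]=[K_1,F_2]=[K_1,K_2]=[K_2,E_1]=[K_2,F_1]=0$; $[E_1,K_1]_q=[K_1,F_1]_q=[E_2,K_2]_q=[K_2,F_2]_q=0$; $[E_1,E_2]=[E_1,F_2]=[F_1,E_2]=[F_1,F_2]=0$; $[E_1,F_1]=\frac{K_1-IK_1^{-1}}{q-q^{-1}}$; $[E_2,F_2]=\frac{IK_2-K_2^{-1}}{q-q^{-1}}$. *)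

(* Defs.v *)
(* The ground field C is the complex numbers R[i] = complex R,
   built over an arbitrary realType R (every realType is isomorphic to the reals). *)
From HB Require Import structures.
From mathcomp Require Import all_boot all_order all_algebra.
From mathcomp Require Import reals.
From mathcomp Require Import complex.
Set Implicit Arguments. Unset Strict Implicit. Unset Printing Implicit Defensive.
Import Order.TTheory GRing.Theory Num.Theory.
Local Open Scope ring_scope.

Definition not_root_of_unity {F : nzRingType} (q : F) :=
  q != 0 /\ forall m : nat, (0 < m)%N -> q ^+ m != 1.

Definition qcomm {F : fieldType} {n : nat} (q : F) (x y : 'M[F]_n) : 'M[F]_n :=
  q *: (x *m y) - q^-1 *: (y *m x).

(* A finite-dimensional W_q-module of dimension n, with a chosen basis:
   the images of the generators E1 E2 F1 F2 K1 K1^{-1} K2 K2^{-1} I I^{-1}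
   acting on column vectors 'cV_n (so products of generators map to matrix
   products in the same order). The fields below are exactly the defining
   relations of W_q. *)
Record Wq_module (F : fieldType) (q : F) (n : nat) := WqModule {
  wE1 : 'M[F]_n; wE2 : 'M[F]_n; wF1 : 'M[F]_n; wF2 : 'M[F]_n;
  wK1 : 'M[F]_n; wK1i : 'M[F]_n; wK2 : 'M[F]_n; wK2i : 'M[F]_n;
  wI : 'M[F]_n; wIi : 'M[F]_n;
  wI_E1 : wI *m wE1 = wE1 *m wI;
  wI_E2 : wI *m wE2 = wE2 *m wI;
  wI_F1 : wI *m wF1 = wF1 *m wI;
  wI_F2 : wI *m wF2 = wF2 *m wI;
  wI_K1 : wI *m wK1 = wK1 *m wI;
  wI_K1i : wI *m wK1i = wK1i *m wI;
  wI_K2 : wI *m wK2 = wK2 *m wI;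
  wI_K2i : wI *m wK2i = wK2i *m wI;
  wIIi : wI *m wIi = 1%:M;  wIiI : wIi *m wI = 1%:M;
  wK1K1i : wK1 *m wK1i = 1%:M;  wK1iK1 : wK1i *m wK1 = 1%:M;
  wK2K2i : wK2 *m wK2i = 1%:M;  wK2iK2 : wK2i *m wK2 = 1%:M;
  wK1_E2 : wK1 *m wE2 = wE2 *m wK1;
  wK1_F2 : wK1 *m wF2 = wF2 *m wK1;
  wK1_K2 : wK1 *m wK2 = wK2 *m wK1;
  wK2_E1 : wK2 *m wE1 = wE1 *m wK2;
  wK2_F1 : wK2 *m wF1 = wF1 *m wK2;
  wE1_K1 : qcomm q wE1 wK1 = 0;
  wK1_F1 : qcomm q wK1 wF1 = 0;
  wE2_K2 : qcomm q wE2 wK2 = 0;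
  wK2_F2 : qcomm q wK2 wF2 = 0;
  wE1_E2 : wE1 *m wE2 = wE2 *m wE1;
  wE1_F2 : wE1 *m wF2 = wF2 *m wE1;
  wF1_E2 : wF1 *m wE2 = wE2 *m wF1;
  wF1_F2 : wF1 *m wF2 = wF2 *m wF1;
  wE1_F1 : wE1 *m wF1 - wF1 *m wE1 = (q - q^-1)^-1 *: (wK1 - wI *m wK1i);
  wE2_F2 : wE2 *m wF2 - wF2 *m wE2 = (q - q^-1)^-1 *: (wI *m wK2 - wK2i)
}.

Definition Wq_gens (F : fieldType) (q : F) (n : nat) (V : Wq_module q n) :
  seq 'M[F]_n :=
  [:: wE1 V; wE2 V; wF1 V; wF2 V; wK1 V; wK1i V; wK2 V; wK2i V; wI V; wIi V].

(* A subspace of the column space 'cV_n is encoded (as usual in mxalgebra)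
   by a square matrix U whose ROW space spans the transposes of its vectors.
   u^T lies in it and A u is in it  iff  u^T *m A^T lies in the row space of U;
   hence U is a submodule iff it is stable under A^T for each generator A. *)
Definition Wq_submodule (F : fieldType) (q : F) (n : nat) (V : Wq_module q n)
  (U : 'M[F]_n) : Prop :=
  forall A, A \in Wq_gens V -> stablemx U A^T.

(* Completely reducible: every submodule has a complementary submodule
   (same notion as mathcomp's mx_completely_reducible / mxsplits). *)
Definition Wq_completely_reducible (F : fieldType) (q : F) (n : nat)
  (V : Wq_module q n) : Prop :=
  forall U : 'M[F]_n, Wq_submodule V U ->
    exists2 W : 'M[F]_n, Wq_submodule V W &
      ((U + W :=: 1%:M)%MS /\ mxdirect (U + W)).

(* Main.v *)
Require Import Defs.
From HB Require Import structures.
From mathcomp Require Import all_boot all_order all_algebra.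
From mathcomp Require Import reals.
From mathcomp Require Import complex.
Import Order.TTheory GRing.Theory Num.Theory.
Local Open Scope ring_scope.
Set Implicit Arguments. Unset Strict Implicit. Unset Printing Implicit Defensive.

(* The operators T1 = K1^2 I^-1 and T2 = K2^2 I are diagonalizable on every
   finite-dimensional module, and they commute with K1, K2 and I; hence each of
   K1, K2, I is diagonalizable as soon as one of them is.  For a single triple
   (x, y, k) of U_q(sl2) type, commuting y past powers of x shows that t = k^2 i^-1
   is killed on ker (y then x) by a product of factors t - q^(-2j), j >= 0,
   and on ker x by a product of factors t - q^(2j), j >= 0.  As q is not a root of
   unity these two facts are incompatible on ker x cap im y (y shifts the
   eigenvalues of t by q^-4), so V = ker x (+) im y, and t is diagonalizable on V
   because it is so on ker x.

   If I, and hence K1 and K2, is diagonalizable, let Hw = ker E1 cap ker E2 be the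
   space of highest weight vectors and U a submodule.  A (K1, K2, I)-stable complement of
   U cap Hw in Hw generates, under F1 and F2, a complement of U: the two
   decompositions ker Ei (+) im Fi = V show that V is generated by Hw and that
   Hw meets im F1 + im F2 trivially.  Conversely, a complement of the sum of the
   eigenspaces of the central operator I contains no eigenvector of I, so it is 0.

   Submodules are row spaces here, so all operators act from the right, through
   the transposes of the matrices of the module. *)

(** * Products of linear factors of a matrix *)

Lemma expr_inj (F : fieldType) (b : F) :
  not_root_of_unity b -> injective (GRing.exp b).
Proof.
move=> [b0 hb] i j; wlog ij : i j / (i <= j)%N => [W e|].
  by case/orP: (leq_total i j) => /W // ->.
rewrite -(subnK ij) exprD -{1}[b ^+ i]mul1r.
move/(mulIf (expf_neq0 i b0)) => /esym/eqP.
by case: (posnP (j - i)%N) => [->|/hb/negPf-> //]; rewrite add0n.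
Qed.

Section ProdMx.
Variables (F : fieldType) (n : nat).
Implicit Types (A B : 'M[F]_n) (s : seq F).

Definition prod_shift A s : 'M[F]_n :=
  foldr (fun a P => (A - a%:M) *m P) 1%:M s.

Lemma comm_shift A B a :
  B *m A = A *m B -> B *m (A - a%:M) = (A - a%:M) *m B.
Proof. by move=> cBA; rewrite mulmxBl mulmxBr cBA scalar_mxC. Qed.

Lemma stablemx_shift m (S : 'M[F]_(m, n)) A a :
  stablemx S A -> stablemx S (A - a%:M).
Proof. by move=> ?; rewrite stablemxD ?stablemxN ?stablemxC. Qed.

Lemma stablemx_prod_shift m (S : 'M[F]_(m, n)) A s :
  stablemx S A -> stablemx S (prod_shift A s).
Proof.
move=> stS; elim: s => [|a s IH] /=; first exact: stablemxC.
by rewrite stablemxM // stablemx_shift.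
Qed.

Lemma prod_shift_comm A B s :
  B *m A = A *m B -> B *m prod_shift A s = prod_shift A s *m B.
Proof.
move=> cBA; elim: s => [|a s IH] /=; first by rewrite mulmx1 mul1mx.
by rewrite mulmxA comm_shift // -!mulmxA IH.
Qed.

Lemma prod_shift_eigen m (V : 'M[F]_(m, n)) A a s :
  V *m (A - a%:M) = 0 -> V *m prod_shift A s = (\prod_(b <- s) (a - b)) *: V.
Proof.
move=> Va; have {Va}VA : V *m A = a *: V.
  by apply/eqP; rewrite -subr_eq0 -mul_mx_scalar -mulmxBr Va.
elim: s => [|b s IH] /=; first by rewrite mulmx1 big_nil scale1r.
rewrite mulmxA mulmxBr VA mul_mx_scalar -scalerBl -scalemxAl IH scalerA.
by rewrite big_cons.
Qed.

(** By induction on [s], [V *m (A - a%:M)] vanishes. So [A] acts on [V] as [a], and the second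
    product multiplies [V] by a scalar that is nonzero because [a] is not in [s']. *)
Lemma prod_shift_coprime m (V : 'M[F]_(m, n)) A s s' :
  (forall a, a \in s -> a \notin s') ->
  V *m prod_shift A s = 0 -> V *m prod_shift A s' = 0 -> V = 0.
Proof.
elim: s => [|a s IH] /= in V * => dis; first by rewrite mulmx1.
rewrite mulmxA => Vs Vs'.
have V1 : V *m (A - a%:M) = 0.
  apply: IH => //; first by move=> b bs; apply: dis; rewrite inE bs orbT.
  rewrite -mulmxA prod_shift_comm ?mulmxA ?Vs' ?mul0mx //.
  exact/esym/comm_shift.
move: Vs'; rewrite (prod_shift_eigen _ V1) => /eqP; rewrite scaler_eq0.
case/orP=> [|/eqP //]; rewrite prodf_seq_eq0 => /hasP[b bs' /=].
by rewrite subr_eq0 => /eqP eab; move: (dis a (mem_head _ _)); rewrite eab bs'.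
Qed.

Lemma prod_shift_twist A B b s : b != 0 -> A *m B = b *: (B *m A) ->
  prod_shift A s *m B =
    b ^+ size s *: (B *m prod_shift A [seq b^-1 * a | a <- s]).
Proof.
move=> b0 AB; elim: s => [|a s IH] /=.
  by rewrite mulmx1 mul1mx expr0 scale1r.
rewrite -mulmxA IH -scalemxAr !mulmxA mulmxBl AB mul_scalar_mx.
have -> : b *: (B *m A) - a *: B = b *: (B *m (A - (b^-1 * a)%:M)).
  by rewrite mulmxBr mul_mx_scalar scalerBr scalerA mulrA divff // mul1r.
by rewrite -scalemxAl scalerA -exprSr.
Qed.

(** A Bezout identity relative to [S]: the difference of [S *m (A - b%:M)] and [S *m (A - a%:M)] is
    [(a - b) *: S] with [a != b], which peels off one factor at a time. *)
Lemma sub_prod_shift m (S : 'M[F]_(m, n)) A a s : stablemx S A -> a \notin s ->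
  (S <= S *m prod_shift A s + S *m (A - a%:M))%MS.
Proof.
elim: s => [|b s IH] /= in m S * => stS; first by rewrite mulmx1 addsmxSl.
rewrite inE negb_or => /andP[nab nas].
have Sab c : (S *m (A - c%:M) <= S)%MS by apply: stablemx_shift.
have cAb c : A *m (A - c%:M) = (A - c%:M) *m A by apply: comm_shift.
have stS' : stablemx (S *m (A - b%:M)) A.
  by rewrite -mulmxA -cAb mulmxA submxMr.
have := IH _ _ stS' nas; rewrite -mulmxA => H.
have {}H : (S *m (A - b%:M) <=
   S *m ((A - b%:M) *m prod_shift A s) + S *m (A - a%:M))%MS.
  apply: submx_trans H _; apply: addsmxS => //.
  exact: submxMr.
have : ((a - b) *: S <= S *m ((A - b%:M) *m prod_shift A s) + S *m (A - a%:M))%MS.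
  have -> : (a - b) *: S = S *m (A - b%:M) - S *m (A - a%:M).
    by rewrite -mulmxBr [A - _ - _]addrC opprB addrA subrK -raddfB mul_mx_scalar.
  by rewrite addmx_sub // eqmx_opp addsmxSr.
apply: submx_trans; rewrite eqmx_scale // subr_eq0 //.
Qed.

(** For a list [a :: s], the summand [S *m prod_shift A s] of [sub_prod_shift] is killed by [A - a],
    and induction applies to the other summand, which [prod_shift A s] kills. *)
Lemma sub_sum_eigenspace m (S : 'M[F]_(m, n)) A s : uniq s -> stablemx S A ->
  S *m prod_shift A s = 0 -> (S <= \sum_(a <- s) (S :&: eigenspace A a))%MS.
Proof.
elim: s => [|a s IH] /= in m S *; first by rewrite mulmx1 => _ _ ->; rewrite sub0mx.
case/andP=> nas us stS S0; rewrite big_cons.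
apply: submx_trans (sub_prod_shift stS nas) _; apply: addsmxS.
  rewrite sub_capmx; apply/andP; split.
    exact: stablemx_prod_shift.
  apply/sub_kermxP; rewrite -mulmxA -prod_shift_comm //.
  exact/esym/comm_shift.
have Sa : (S *m (A - a%:M) <= S)%MS by apply: stablemx_shift.
apply: submx_trans (IH _ (S *m (A - a%:M)) us _ _) _.
- by rewrite -mulmxA -comm_shift // mulmxA submxMr.
- by rewrite -mulmxA.
elim: s {IH us S0 nas} => [|b s IH]; first by rewrite !big_nil.
by rewrite !big_cons; apply: addsmxS IH; apply: capmxS.
Qed.

Lemma diagonalizable_prod_shift A : diagonalizable A ->
  exists2 s, uniq s & prod_shift A s = 0.
Proof.
case/diagonalizablePeigen=> s us s1; exists s => //.
rewrite -[LHS]mul1mx; apply/sub_kermxP; rewrite -s1.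
rewrite (big_nth 0) big_mkord; apply/sumsmx_subP => i _; apply/sub_kermxP.
have /eigenspaceP Ei := submx_refl (eigenspace A s`_i).
rewrite (@prod_shift_eigen _ _ _ s`_i) ?mulmxBr ?Ei ?mul_mx_scalar ?subrr //.
rewrite (_ : \prod_(_ <- _) _ = 0) ?scale0r //.
apply/eqP; rewrite prodf_seq_eq0; apply/hasP; exists s`_i; rewrite ?mem_nth //=.
by rewrite subrr.
Qed.

End ProdMx.

(** * Annihilating products over an algebraically closed field *)

Section Closed.
Variables (F : closedFieldType) (n : nat).
Implicit Types (A : 'M[F]_n).

Lemma closed_prod_shift A : exists s, prod_shift A s = 0.
Proof.
case: n A => [|m] A; first by exists [::]; apply/matrixP; case.
have [s ps] := closed_field_poly_normal (char_poly A).
exists s; have := Cayley_Hamilton A; rewrite ps.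
rewrite (monicP (char_poly_monic A)) scale1r rmorph_prod /= => H.
rewrite -[RHS]H /prod_shift -[foldr _ _ _]/(foldr _ _ s) {ps H}.
elim: s => [|a s IH]; rewrite ?big_nil ?big_cons //= IH.
by rewrite rmorphB /= horner_mx_X horner_mx_C.
Qed.

Lemma eq0_cap_eigenspace m (S : 'M[F]_(m, n)) A : stablemx S A ->
  (forall a, (S :&: eigenspace A a)%MS = 0) -> S = 0.
Proof.
move=> stS H; have [s s0] := closed_prod_shift A.
have : S *m prod_shift A s = 0 by rewrite s0 mulmx0.
elim: s {s0} => [|a s IH] /=; first by rewrite mulmx1.
move=> Hs; apply: IH; apply/eqP; rewrite -submx0 -(H a) sub_capmx; apply/andP; split.
  exact: stablemx_prod_shift.
by apply/sub_kermxP; rewrite -mulmxA -prod_shift_comm //; apply/esym/comm_shift.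
Qed.

(** The invertible [K] carries an eigenvector of [X] for [a] to one for [b^-1 * a]. If [a != 0] this
    produces infinitely many eigenvalues, so only the eigenvalue 0 is possible. *)
Lemma qcommuting_nilpotent (b : F) (X K K' : 'M[F]_n) : not_root_of_unity b ->
  K *m K' = 1%:M -> X *m K = b *: (K *m X) -> exists N, X ^+ N = 0.
Proof.
move=> [b0 hb] KK' XK.
have noeig a m (V : 'M_(m, n)) : a != 0 -> V *m X = a *: V -> V = 0.
  move=> a0 Va.
  have Vk j : (V *m K ^+ j) *m X = (b^-1 ^+ j * a) *: (V *m K ^+ j).
    elim: j => [|j IH]; first by rewrite expr0 mulmx1 mul1r.
    rewrite exprSr -mulmxE mulmxA.
    have -> : V *m K ^+ j *m K *m X = b^-1 *: (V *m K ^+ j *m X *m K).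
      by rewrite -!mulmxA XK -!scalemxAr scalerA mulVf // scale1r.
    by rewrite IH -scalemxAl scalerA mulrA -exprS.
  have [s s0] := closed_prod_shift X.
  pose a_ j := b^-1 ^+ j * a.
  have a_inj : injective a_.
    by move=> i j /(mulIf a0); rewrite !exprVn => /invr_inj/expr_inj; apply.
  (* Pigeonhole: the [size s + 1] distinct values [a_ j] cannot all occur in [s]. *)
  have [j nj] : exists j, a_ j \notin s.
    have [/allP sub|/allPn[_ /mapP[j _ ->] nj]] :=
        boolP (all [in s] [seq a_ j | j <- iota 0 (size s).+1]); last by exists j.
    have /uniq_leq_size : uniq [seq a_ j | j <- iota 0 (size s).+1].
      by rewrite map_inj_uniq // iota_uniq.
    by move/(_ _ sub); rewrite size_map size_iota ltnn.
  have := @prod_shift_eigen F n _ (V *m K ^+ j) X (a_ j) s.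
  rewrite mulmxBr Vk mul_mx_scalar subrr => /(_ erefl); rewrite s0 mulmx0.
  move/esym/eqP; rewrite scaler_eq0 prodf_seq_eq0 => /orP[/hasP[c cs /=]|/eqP].
    by rewrite subr_eq0 => /eqP e; rewrite e cs in nj.
  move=> VKj; rewrite -[V]mulmx1 (_ : 1%:M = K ^+ j *m K' ^+ j).
    by rewrite mulmxA VKj mul0mx.
  by elim: j {VKj nj} => [|j IH]; rewrite ?expr0 ?mulmx1 //
    exprS exprSr -!mulmxE mulmxA -(mulmxA K) -IH mulmx1 KK'.
(* The annihilating product is stripped factor by factor behind a power [Y] of [X]: a factor with
   [a = 0] is absorbed into [Y], any other one is cancelled by [noeig]. *)
have [s s0] := closed_prod_shift X.
have : 1%:M *m prod_shift X s = 0 by rewrite mul1mx.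
have : exists N, (1%:M : 'M[F]_n) = X ^+ N by exists 0.
move: (1%:M) => Y; elim: s {s0} Y => [|a s IH] Y /= [N YN].
  by rewrite mulmx1 => Y0; exists N; rewrite -YN.
have [->|a0] := eqVneq a 0; rewrite mulmxA.
  rewrite raddf0 subr0; by apply: IH; exists N.+1; rewrite YN exprSr.
move=> H; apply: IH; first by exists N.
apply: (noeig a) => //; apply/eqP; rewrite -subr_eq0 -mul_mx_scalar -mulmxBr.
rewrite -YN -mulmxA -prod_shift_comm ?mulmxA ?H //; exact/esym/comm_shift.
Qed.
End Closed.

(** * Triples of U_q(sl2) type *)

(* Operators act on row vectors from the right, so [y *m x] is "first y, then x". *)
Record qsl2 (F : fieldType) n (q c : F) (x y k ki i ii : 'M[F]_n) : Prop := Qsl2 {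
  qsl2_q : not_root_of_unity q;
  qsl2_c : c != 0;
  qsl2_kki : k *m ki = 1%:M;
  qsl2_iii : i *m ii = 1%:M;
  qsl2_ix : i *m x = x *m i;
  qsl2_iy : i *m y = y *m i;
  qsl2_ik : i *m k = k *m i;
  qsl2_xk : x *m k = q ^+ 2 *: (k *m x);
  qsl2_yk : y *m k = q^-1 ^+ 2 *: (k *m y);
  qsl2_yx : y *m x - x *m y = c *: (k - i *m ki) }.

Lemma not_root_of_unityV (F : fieldType) (q : F) :
  not_root_of_unity q -> not_root_of_unity q^-1.
Proof.
by case=> q0 hq; split=> [|m m0]; rewrite ?invr_eq0 // exprVn invr_eq1 hq.
Qed.

Lemma not_root_of_unityX (F : fieldType) (q : F) m :
  (0 < m)%N -> not_root_of_unity q -> not_root_of_unity (q ^+ m).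
Proof.
move=> m0 [q0 hq]; split=> [|j j0]; first by rewrite expf_neq0.
by rewrite -exprM hq // muln_gt0 m0.
Qed.

(** This symmetry lets every fact about [x] serve again for [y], with [q^-1] in place of [q]. *)
Lemma qsl2_swap (F : fieldType) n (q c : F) (x y k ki i ii : 'M[F]_n) :
  qsl2 q c x y k ki i ii -> qsl2 q^-1 (- c) y x k ki i ii.
Proof.
case=> hq hc h1 h2 h3 h4 h5 h6 h7 h8; split; rewrite ?oppr_eq0 ?invrK //.
  exact: not_root_of_unityV.
by rewrite scaleNr -h8 opprB.
Qed.

Lemma comm_mxV (F : fieldType) n (A B B' : 'M[F]_n) :
  B *m B' = 1%:M -> A *m B = B *m A -> A *m B' = B' *m A.
Proof.
move=> BB' AB; have B'B := mulmx1C BB'.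
by rewrite -[LHS]mul1mx -B'B -mulmxA (mulmxA B) -AB -mulmxA BB' mulmx1.
Qed.

Lemma qcomm_weight (F : fieldType) n (b : F) (x k i ii : 'M[F]_n) :
  i *m ii = 1%:M -> i *m x = x *m i -> x *m k = b ^+ 2 *: (k *m x) ->
  x *m (k *m k *m ii) = b ^+ 4 *: (k *m k *m ii *m x).
Proof.
move=> iii ix xk; rewrite !mulmxA xk -!scalemxAl -(mulmxA k x) xk.
rewrite -!scalemxAr -!scalemxAl scalerA -exprD; congr (_ *: _).
by rewrite -!mulmxA; congr (_ *m (_ *m _)); apply: comm_mxV iii _.
Qed.

Section Sl2.
Variables (F : closedFieldType) (n : nat).

Definition qnum (b : F) m : F := \sum_(j < m) b ^+ j.

Lemma qnumS b m : qnum b m.+1 = 1 + b * qnum b m.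
Proof.
rewrite /qnum big_ord_recl expr0; congr (_ + _); rewrite mulr_sumr.
by apply: eq_bigr => j _; rewrite exprS.
Qed.

Lemma qnum_neq0 b m : not_root_of_unity b -> qnum b m.+1 != 0.
Proof.
move=> [b0 hb]; have := hb m.+1 isT; apply: contraNneq => q0.
by rewrite -subr_eq0 subrX1 -/(qnum b m.+1) q0 mulr0.
Qed.

Lemma qnumV b m : b != 0 -> qnum b m.+1 = b ^+ m * qnum b^-1 m.+1.
Proof.
move=> b0; rewrite /qnum mulr_sumr (reindex_inj rev_ord_inj).
apply: eq_bigr => j _ /=; rewrite subSS exprVn.
by apply: (canRL (mulfK (expf_neq0 j b0))); rewrite -exprD subnK // leq_ord.
Qed.

(** * Commutation of y with the powers of x *)

Section One.
Variables (q c : F) (x y k ki i ii : 'M[F]_n).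
Hypothesis H : qsl2 q c x y k ki i ii.

Let q0 : q != 0. Proof. by case: (qsl2_q H). Qed.
Let kki := qsl2_kki H.
Let iii := qsl2_iii H.
Let ix := qsl2_ix H.
Let xk := qsl2_xk H.

Variable t : 'M[F]_n.
Hypothesis tE : t = k *m k *m ii.

Lemma qsl2_xki : x *m ki = q^-1 ^+ 2 *: (ki *m x).
Proof.
rewrite -[LHS]mul1mx -(mulmx1C kki) -mulmxA (mulmxA k).
have -> : k *m x = q^-1 ^+ 2 *: (x *m k).
  by rewrite xk scalerA -exprMn mulVf // expr1n scale1r.
by rewrite -scalemxAl -mulmxA kki mulmx1 -scalemxAr.
Qed.

Lemma qsl2_xt : x *m t = q ^+ 4 *: (t *m x).
Proof. rewrite tE; exact: qcomm_weight (qsl2_iii H) (qsl2_ix H) (qsl2_xk H). Qed.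

Lemma qsl2_yt : y *m t = q^-1 ^+ 4 *: (t *m y).
Proof. rewrite tE; exact: qcomm_weight (qsl2_iii H) (qsl2_iy H) (qsl2_yk H). Qed.

(** The coefficient of [x ^+ m.-1] in the commutator of [y] with [x ^+ m]: moving the [m] copies of
    [c *: (k - i *m ki)] to the left of the powers of [x] scales [k] by powers of [q ^+ 2] and [ki]
    by powers of [q^-1 ^+ 2]. *)
Definition ladder m : 'M[F]_n :=
  c *: (qnum (q ^+ 2) m *: k - qnum (q^-1 ^+ 2) m *: (i *m ki)).

Lemma raise_ladder m :
  x *m ladder m + c *: (k - i *m ki) *m x = ladder m.+1 *m x.
Proof.
rewrite /ladder -scalemxAr -!scalemxAl -scalerDr; congr (_ *: _).
rewrite !qnumS !mulmxBr !mulmxBl -!scalemxAr xk mulmxA -ix -mulmxA qsl2_xki.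
rewrite -!scalemxAr !scalerA -!scalemxAl !mulmxA addrACA -opprD.
by congr (_ - _); rewrite -{2}[_ *m x]scale1r -scalerDl addrC ![_ ^+ 2 * _]mulrC.
Qed.

Lemma comm_raise m : y *m x ^+ m.+1 = x ^+ m.+1 *m y + ladder m.+1 *m x ^+ m.
Proof.
have yx : y *m x = x *m y + c *: (k - i *m ki).
  by rewrite -(qsl2_yx H) addrC subrK.
elim: m => [|m IH].
  rewrite expr1 expr0 mulmx1 yx /ladder /qnum !big_ord_recl !big_ord0 !expr0.
  by rewrite !addr0 !scale1r.
rewrite [in LHS]exprS -mulmxE mulmxA yx mulmxDl -mulmxA IH.
rewrite [x ^+ m.+2]exprS [X in _ *: _ *m X]exprS -!mulmxE mulmxDr !mulmxA.
by rewrite -addrA -mulmxDl raise_ladder [x ^+ m.+1]exprS -!mulmxE !mulmxA.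
Qed.

(** By [qnumV] the two q-integers differ by a power of [q ^+ 2], and [k] is [t *m (i *m ki)]; this
    isolates the only factor of [ladder] that can be singular. *)
Lemma ladderE m : ladder m.+1 =
  (c * qnum (q^-1 ^+ 2) m.+1 * q ^+ 2 ^+ m) *:
     ((t - (q^-1 ^+ 2 ^+ m)%:M) *m (i *m ki)).
Proof.
rewrite /ladder qnumV ?expf_neq0 // -exprVn mulmxBl mul_scalar_mx.
have -> : t *m (i *m ki) = k.
  rewrite tE -mulmxA (mulmxA ii) (mulmx1C iii) mul1mx -mulmxA kki.
  by rewrite mulmx1.
rewrite -!scalerA; congr (_ *: _); rewrite !scalerBr !scalerA.
congr (_ *: _ - _ *: _); first by rewrite mulrC exprVn.
by rewrite -mulrA -exprMn exprVn mulfV ?expf_neq0 // expr1n mulr1 -exprVn.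
Qed.

(** The scalar in [ladderE] is nonzero since [q] is not a root of unity. The invertible [i *m ki]
    passes [x ^+ j] up to a nonzero scalar, so it can be cancelled on the right. *)
Lemma ladder_cancel m p (V : 'M[F]_(p, n)) j : V *m ladder m.+1 *m x ^+ j = 0 ->
  V *m (t - (q^-1 ^+ 2 ^+ m)%:M) *m x ^+ j = 0.
Proof.
rewrite ladderE -scalemxAr -scalemxAl => /eqP; rewrite scaler_eq0.
have /negPf-> : c * qnum (q^-1 ^+ 2) m.+1 * q ^+ 2 ^+ m != 0.
  rewrite !mulf_neq0 ?(qsl2_c H) // ?expf_neq0 // qnum_neq0 //.
  by apply: not_root_of_unityX => //; apply: not_root_of_unityV; case: H.
move=> /= /eqP; rewrite (mulmxA V) -[_ *m (i *m ki) *m _]mulmxA.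
have [b b0 ->] : exists2 b, b != 0 & i *m ki *m x ^+ j = b *: (x ^+ j *m (i *m ki)).
  elim: j => [|j [b b0 IH]].
    by exists 1; rewrite ?oner_neq0 ?scale1r ?expr0 ?mul1mx ?mulmx1.
  exists (q ^+ 2 * b); first by rewrite !mulf_neq0 // expf_neq0.
  rewrite exprS -mulmxE mulmxA.
  have -> : i *m ki *m x = q ^+ 2 *: (x *m (i *m ki)).
    rewrite (mulmxA x) -ix -!mulmxA qsl2_xki -scalemxAr scalerA -exprMn mulfV //.
    by rewrite expr1n scale1r.
  by rewrite -scalemxAl -(mulmxA x) IH -scalemxAr scalerA -(mulmxA x).
rewrite -scalemxAr => /eqP; rewrite scaler_eq0 (negPf b0) /= => /eqP V0.
move/(congr1 (mulmx^~ (k *m ii))): V0; rewrite mul0mx => <-.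
by rewrite -!mulmxA (mulmxA ki) (mulmx1C kki) mul1mx iii mulmx1.
Qed.

(** Applying [V] to [comm_raise] leaves only the [ladder] term, so [V *m (t - a%:M)] is killed by
    [x ^+ N]. As [t] commutes with [y *m x], the induction hypothesis applies to it. *)
Lemma ladder_kernel p (V : 'M[F]_(p, n)) N : V *m y *m x = 0 -> V *m x ^+ N = 0 ->
  exists s, [/\ uniq s,
    forall a, a \in s -> exists2 j, (j < N)%N & a = q^-1 ^+ 2 ^+ j &
    V *m prod_shift t s = 0].
Proof.
elim: N V => [|N IH] V Vyx.
  by rewrite expr0 => V0; exists [::].
move=> VN; set a := q^-1 ^+ 2 ^+ N.
have V1 : V *m (t - a%:M) *m x ^+ N = 0.
  apply: ladder_cancel; apply/eqP; rewrite -mulmxA -(inj_eq (addrI (V *m (x ^+ N.+1 *m y)))).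
  rewrite -mulmxDr -comm_raise addr0 exprS -mulmxE !mulmxA Vyx mul0mx.
  by rewrite -(mulmxA V x) mulmxE -exprS VN mul0mx.
have tyx : y *m x *m t = t *m (y *m x).
  rewrite -mulmxA qsl2_xt -scalemxAr (mulmxA y t) qsl2_yt -scalemxAl scalerA.
  by rewrite -exprMn mulfV // expr1n scale1r mulmxA.
have [|s [us hs Vs]] := IH _ _ V1.
  by rewrite -!mulmxA -comm_shift // !mulmxA -[V *m _ *m _]mulmxA mulmxA Vyx mul0mx.
exists (a :: s); split; last by rewrite /= mulmxA.
- rewrite /= us andbT; apply/negP => /hs[j jN /expr_inj e].
  rewrite e ?ltnn // in jN.
  by apply: not_root_of_unityX => //; apply: not_root_of_unityV; case: H.
by move=> b; rewrite inE => /orP[/eqP->|/hs[j jN ->]]; [exists N|exists j; rewrite // ltnW].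
Qed.
End One.

(** * Nilpotency and the decomposition of the space as ker x plus im y *)

Lemma raise_nilpotent q c (x y k ki i ii : 'M[F]_n) :
  qsl2 q c x y k ki i ii -> exists N, x ^+ N = 0.
Proof.
move=> H; apply: qcommuting_nilpotent (qsl2_kki H) (qsl2_xk H).
exact: not_root_of_unityX (qsl2_q H).
Qed.

Lemma lower_nilpotent q c (x y k ki i ii : 'M[F]_n) :
  qsl2 q c x y k ki i ii -> exists N, y ^+ N = 0.
Proof. by move/qsl2_swap/raise_nilpotent. Qed.

(** Pushing [y] through the annihilator of [V] gives one of [V *m y] with roots [q^(-4-2j)]; the
    swapped triple gives one with roots [q^(2l)]. A common root would force [q^(4+2j+2l) = 1]. *)
Lemma lower_kernel q c (x y k ki i ii : 'M[F]_n) p (V : 'M[F]_(p, n)) :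
  qsl2 q c x y k ki i ii -> V *m y *m x = 0 -> V *m y = 0.
Proof.
move=> H Vyx; have [q0 hq] := qsl2_q H.
have [[N xN] [M yM]] := (raise_nilpotent H, lower_nilpotent H).
have [|s [_ hs Vs]] := ladder_kernel H erefl (N := N) Vyx.
  by rewrite xN mulmx0.
have [||s' [_ hs' Vs']] := ladder_kernel (qsl2_swap H) erefl (V := V *m y) (N := M).
- by rewrite Vyx mul0mx.
- by rewrite yM mulmx0.
move/(congr1 (mulmx^~ y)): Vs; rewrite mul0mx -mulmxA.
have b0 : q ^+ 4 != 0 by rewrite expf_neq0.
rewrite (@prod_shift_twist _ _ _ _ (q ^+ 4)) //; last first.
  by rewrite (qsl2_yt H erefl) scalerA -exprMn mulfV // expr1n scale1r.
rewrite -scalemxAr mulmxA => /eqP.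
rewrite scaler_eq0 expf_eq0 (negPf b0) andbF => /eqP Vs.
apply: prod_shift_coprime Vs Vs' => a /mapP[b /hs [j _ ->] ->].
apply/negP => /hs' [l _]; rewrite invrK => e.
have /negP[] := hq (4 + 2 * j + 2 * l)%N isT; apply/eqP.
by rewrite exprD [X in _ * X]exprM -e !exprVn -exprM -invfM -exprD mulfV ?expf_neq0.
Qed.

Lemma ker_raise_cap_lower q c (x y k ki i ii : 'M[F]_n) :
  qsl2 q c x y k ki i ii -> (kermx x :&: y)%MS = 0.
Proof.
move=> H; apply/eqP/rowV0P => v; rewrite sub_capmx => /andP[/sub_kermxP vx].
by case/submxP=> w vw; rewrite vw in vx *; apply: lower_kernel H vx.
Qed.

Lemma rank_lower q c (x y k ki i ii : 'M[F]_n) :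
  qsl2 q c x y k ki i ii -> (\rank y <= \rank x)%N.
Proof.
move=> H; have := mxrank_sum_cap (kermx x) y.
rewrite (ker_raise_cap_lower H) mxrank0 addn0 mxrank_ker => e.
have := rank_leq_col (kermx x + y)%MS; rewrite e.
by rewrite -leq_subRL ?leq_subr // subKn // rank_leq_row.
Qed.

(** [rank_lower] for the triple and for its swap makes the ranks of [x] and [y] equal, so the
    dimensions of the two independent summands add up to [n]. *)
Lemma ker_raise_add_lower q c (x y k ki i ii : 'M[F]_n) :
  qsl2 q c x y k ki i ii -> (1%:M <= kermx x + y)%MS.
Proof.
move=> H; rewrite sub1mx /row_full.
have := mxrank_sum_cap (kermx x) y.
rewrite (ker_raise_cap_lower H) mxrank0 addn0 mxrank_ker => ->.
have -> : \rank y = \rank x.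
  by apply/eqP; rewrite eqn_leq (rank_lower H) (rank_lower (qsl2_swap H)).
by rewrite subnK // rank_leq_row.
Qed.

(** A Nakayama argument: substituting the inclusion into itself replaces [S *m y] by
    [S *m y ^+ N]. *)
Lemma nilpotent_generation (y S Z : 'M[F]_n) N : y ^+ N = 0 -> stablemx Z y ->
  (S <= Z + S *m y)%MS -> (S <= Z)%MS.
Proof.
move=> yN stZ SZ; suff: (S <= Z + S *m y ^+ N)%MS by rewrite yN mulmx0 addsmx0_id.
elim: N {yN} => [|N IH]; first by rewrite expr0 mulmx1 addsmxSr.
apply: submx_trans SZ _; rewrite addsmx_sub addsmxSl /=.
apply: submx_trans (submxMr _ IH) _; rewrite addsmxMr.
by rewrite exprSr -mulmxE mulmxA addsmxS.
Qed.

(** If [S *m x ^+ N.+1] vanishes, then [S *m x ^+ N] lies in [S] and in the kernel of [x], so it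
    vanishes too. *)
Lemma nilpotent_socle (x S : 'M[F]_n) N : x ^+ N = 0 -> stablemx S x ->
  (S :&: kermx x)%MS = 0 -> S = 0.
Proof.
move=> xN stS S0; have : S *m x ^+ N = 0 by rewrite xN mulmx0.
elim: N {xN} => [|N IH]; first by rewrite expr0 mulmx1.
rewrite exprSr -mulmxE mulmxA => SN; apply: IH; apply/eqP.
rewrite -submx0 -S0 sub_capmx; apply/andP; split; last exact/sub_kermxP.
elim: N {SN} => [|N IH]; first by rewrite expr0 mulmx1.
by rewrite exprSr -mulmxE mulmxA; apply: submx_trans (submxMr _ IH) stS.
Qed.

(** Summing over the distinct roots of the characteristic polynomial keeps the sum finite; all other
    eigenspaces are zero. *)
Definition eigsum (A : 'M[F]_n) : 'M[F]_n :=
  (\sum_(a <- undup (sval (closed_field_poly_normal (char_poly A))))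
     eigenspace A a)%MS.

Lemma sub_eigsum A a : (eigenspace A a <= eigsum A)%MS.
Proof.
rewrite /eigsum; set s := undup _.
have us : uniq s by apply: undup_uniq.
have [ains|nas] := boolP (a \in s); first by rewrite (bigD1_seq a) //= addsmxSl.
suff -> : eigenspace A a = 0 by apply: sub0mx.
apply/eqP; rewrite -[_ == 0]negbK; apply: contra nas => Ea.
have : eigenvalue A a by [].
rewrite eigenvalue_root_char mem_undup; case: closed_field_poly_normal => r /= ->.
by rewrite (monicP (char_poly_monic A)) scale1r root_prod_XsubC.
Qed.

Lemma eigsum_subP A (Z : 'M[F]_n) :
  (forall a, (eigenspace A a <= Z)%MS) -> (eigsum A <= Z)%MS.
Proof. by move=> AZ; rewrite /eigsum (big_nth 0) big_mkord; apply/sumsmx_subP. Qed.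

(** [B] sends the eigenspace of [A] for [a] into the one for [b * a]. *)
Lemma stablemx_eigsum (b : F) A B :
  B *m A = b *: (A *m B) -> stablemx (eigsum A) B.
Proof.
move=> BA.
suff : (eigsum A <= kermx (B *m cokermx (eigsum A)))%MS.
  by rewrite sub_kermx submxE mulmxA.
apply: eigsum_subP => a; rewrite sub_kermx mulmxA -submxE.
apply: submx_trans (sub_eigsum A (b * a)).
have /eigenspaceP EA := submx_refl (eigenspace A a).
by apply/eigenspaceP; rewrite -mulmxA BA -scalemxAr mulmxA EA -scalemxAl scalerA.
Qed.

Lemma diagonalizable_eigsum A : diagonalizable A <-> (1%:M <= eigsum A)%MS.
Proof.
split=> [/diagonalizablePeigen[s us s1]|A1].
  rewrite -s1 (big_nth 0) big_mkord; apply/sumsmx_subP => j _; exact: sub_eigsum.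
apply/diagonalizablePeigen.
exists (undup (sval (closed_field_poly_normal (char_poly A)))); first exact: undup_uniq.
by apply/eqmxP; rewrite submx1.
Qed.

(** The sum of the eigenspaces of [t] is stable under [y], so by [nilpotent_generation] it need only
    contain [kermx x]; there the swapped [ladder_kernel] annihilates by a product with distinct
    roots. *)
Lemma weight_diagonalizable q c (x y k ki i ii : 'M[F]_n) :
  qsl2 q c x y k ki i ii -> diagonalizable (k *m k *m ii).
Proof.
move=> H; set t := k *m k *m ii; apply/diagonalizable_eigsum.
have [[N xN] [M yM]] := (raise_nilpotent H, lower_nilpotent H).
apply: (nilpotent_generation yM).
  exact: stablemx_eigsum (qsl2_yt H erefl).
apply: submx_trans (ker_raise_add_lower H) _; rewrite mul1mx; apply: addsmxS => //.
have [||s [us _ xs]] := ladder_kernel (qsl2_swap H) erefl (V := kermx x) (N := M).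
- by rewrite mulmx_ker mul0mx.
- by rewrite yM mulmx0.
apply: submx_trans (sub_sum_eigenspace us _ xs) _; last first.
  rewrite (big_nth 0) big_mkord; apply/sumsmx_subP => j _.
  by apply: submx_trans (capmxSr _ _) (sub_eigsum _ _).
apply/sub_kermxP; rewrite -mulmxA -/t.
have -> : t *m x = (q ^+ 4)^-1 *: (x *m t).
  rewrite (qsl2_xt H erefl) scalerA mulVf ?scale1r // expf_neq0 //.
  by case: (qsl2_q H).
by rewrite -scalemxAr mulmxA mulmx_ker mul0mx scaler0.
Qed.
End Sl2.

(** * Commuting diagonalizable matrices *)

Lemma diagonalizable_trmx (F : fieldType) n (A : 'M[F]_n) :
  diagonalizable A^T <-> diagonalizable A.
Proof.
suff W (B : 'M[F]_n) : diagonalizable B -> diagonalizable B^T.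
  by split=> [/W|/W //]; rewrite trmxK.
case=> P uP /(diagonalizable_forLR uP)[d ->].
exists (invmx P^T); first by rewrite unitmx_inv unitmx_tr.
apply/(diagonalizable_forLR _); first by rewrite unitmx_inv unitmx_tr.
exists d; rewrite !mxpoly.conjumx ?unitmx_inv ?unitmx_tr // !invmxK !trmx_mul tr_diag_mx.
by rewrite trmx_inv mulmxA.
Qed.

Section DiagonalizableAlgebra.
Variables (F : closedFieldType) (n : nat).
Implicit Types A B S U W : 'M[F]_n.

Lemma stable_sub_sum_eigenspace m (S : 'M[F]_(m, n)) A :
  diagonalizable A -> stablemx S A ->
  exists s, (S <= \sum_(a <- s) (S :&: eigenspace A a))%MS.
Proof.
move=> /diagonalizable_prod_shift[s us s0] stS; exists s.
by apply: sub_sum_eigenspace => //; rewrite s0 mulmx0.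
Qed.

Lemma diagonalizable_mulmx A B : A *m B = B *m A ->
  diagonalizable A -> diagonalizable B -> diagonalizable (A *m B).
Proof.
move=> cAB /diagonalizable_eigsum dA dB; apply/diagonalizable_eigsum.
apply: submx_trans dA _; apply: eigsum_subP => a.
have EA m (V : 'M_(m, n)) : (V <= eigenspace A a)%MS -> V *m A = a *: V.
  by move/eigenspaceP.
have st : stablemx (eigenspace A a) B.
  apply/eigenspaceP; rewrite -mulmxA -cAB mulmxA (EA _ _ (submx_refl _)).
  by rewrite scalemxAl.
have [s] := stable_sub_sum_eigenspace dB st; move/submx_trans; apply.
rewrite (big_nth 0) big_mkord; apply/sumsmx_subP => j _.
set V := (_ :&: _)%MS.
apply: submx_trans (sub_eigsum (A *m B) (a * s`_j)); apply/eigenspaceP.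
have /eigenspaceP VB : (V <= eigenspace B s`_j)%MS by apply: capmxSr.
by rewrite mulmxA (EA _ V) ?capmxSl // -scalemxAl VB scalerA.
Qed.

Lemma diagonalizable_inv A B : A *m B = 1%:M -> diagonalizable A -> diagonalizable B.
Proof.
move=> AB /diagonalizable_eigsum dA; apply/diagonalizable_eigsum.
apply: submx_trans dA _; apply: eigsum_subP => a.
apply: submx_trans (sub_eigsum B a^-1); apply/eigenspaceP.
have /eigenspaceP EA := submx_refl (eigenspace A a).
have [a0|a0] := eqVneq a 0.
  have -> : eigenspace A a = 0; last by rewrite mul0mx scaler0.
  by rewrite -[LHS]mulmx1 -AB mulmxA EA a0 scale0r mul0mx.
by apply: (canRL (scalerK a0)); rewrite scalemxAl -EA -mulmxA AB mulmx1.
Qed.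

(** With [r ^+ 2 = a], the eigenspace [V] of [A *m A] is spanned by [V *m A + r *: V] and
    [V *m A - r *: V], which lie in the eigenspaces of [A] for [r] and [- r]. If [r = 0],
    invertibility of [A] gives [V = 0]. *)
Lemma diagonalizable_sqrt A B : (2 : F) != 0 -> A *m B = 1%:M ->
  diagonalizable (A *m A) -> diagonalizable A.
Proof.
move=> n2 AB /diagonalizable_eigsum dA; apply/diagonalizable_eigsum.
apply: submx_trans dA _; apply: eigsum_subP => a.
set V := eigenspace _ a.
have /eigenspaceP EA := submx_refl V.
have [r ra] : exists r, r ^+ 2 = a.
  have [r] := @solve_monicpoly F 2 (fun j => if j is 0 then a else 0) isT.
  by rewrite !big_ord_recl big_ord0 mul0r !addr0 expr0 mulr1 => ?; exists r.
have [r0|r0] := eqVneq r 0.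
  have -> : V = 0; last exact: sub0mx.
  rewrite -[V]mulmx1 -(_ : A *m A *m (B *m B) = 1%:M).
    by rewrite (mulmxA V) EA -ra r0 expr0n scale0r mul0mx.
  by rewrite mulmxA -(mulmxA A A) AB mulmx1.
have -> : V = (2 * r)^-1 *: ((V *m A + r *: V) - (V *m A - r *: V)).
  rewrite opprB addrC addrA subrK -scalerDl scalerA.
  by rewrite -mulr2n -[r *+ 2]mulr_natl mulVf ?scale1r // mulf_neq0.
apply: scalemx_sub; rewrite addmx_sub ?eqmx_opp //.
  apply: submx_trans (sub_eigsum A r); apply/eigenspaceP.
  by rewrite mulmxDl -mulmxA EA -ra -scalemxAl scalerDr scalerA addrC.
apply: submx_trans (sub_eigsum A (- r)); apply/eigenspaceP.
rewrite mulmxBl -mulmxA EA -ra -scalemxAl scalerBr scalerA mulNr !scaleNr opprK.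
by rewrite addrC.
Qed.

Lemma common_eigenvectors (As : seq 'M[F]_n) S :
  {in As &, forall A B, A *m B = B *m A} ->
  {in As, forall A, diagonalizable A} -> {in As, forall A, stablemx S A} ->
  exists2 s : seq 'rV[F]_n,
    {in s, forall v, (v <= S)%MS /\ {in As, forall A, exists a, v *m A = a *: v}} &
    (S <= \sum_(v <- s) <<v>>)%MS.
Proof.
elim: As S => [|A As IH] S cAs dAs stS.
  exists [seq row i S | i <- enum 'I_n].
    by move=> v /mapP[i _ ->]; split=> //; apply: row_sub.
  apply/row_subP => i; rewrite big_map (bigD1_seq i) ?mem_enum ?enum_uniq //=.
  by rewrite (submx_trans _ (addsmxSl _ _)) // genmxE.
have AAs : A \in A :: As by apply: mem_head.
have AsAs B : B \in As -> B \in A :: As by move=> BAs; rewrite inE BAs orbT.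
have [s Ss] := stable_sub_sum_eigenspace (dAs _ AAs) (stS _ AAs).
suff [s' hs' ss'] : exists2 s' : seq 'rV[F]_n,
    {in s', forall v, (v <= S)%MS /\ {in A :: As, forall A, exists a, v *m A = a *: v}} &
    (\sum_(a <- s) (S :&: eigenspace A a) <= \sum_(v <- s') <<v>>)%MS.
  by exists s' => //; apply: submx_trans Ss ss'.
elim: s {Ss} => [|a s [s' hs' ss']]; first by exists [::] => //; rewrite big_nil sub0mx.
have [||B BAs|s1 hs1 ss1] := IH (S :&: eigenspace A a)%MS.
- by move=> B C /AsAs ? /AsAs ?; apply: cAs.
- by move=> B /AsAs; apply: dAs.
- rewrite sub_capmx; apply/andP; split.
    by apply: submx_trans (submxMr _ (capmxSl _ _)) (stS _ (AsAs _ BAs)).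
  apply: submx_trans (submxMr _ (capmxSr _ _)) _; apply/eigenspaceP.
  have /eigenspaceP EA := submx_refl (eigenspace A a).
  by rewrite -mulmxA (cAs B A (AsAs _ BAs) AAs) mulmxA EA scalemxAl.
exists (s1 ++ s').
  move=> v; rewrite mem_cat => /orP[/hs1|/hs' //]; rewrite sub_capmx.
  case=> /andP[vS /eigenspaceP vA] hv; split=> // B; rewrite inE.
  by case/orP=> [/eqP->|/hv //]; exists a.
by rewrite big_cons big_cat; apply: addsmxS.
Qed.

(** Greedy extension: each common eigenvector from a spanning list of [S] is adjoined to [W] when it
    lies outside [U + W]; adjoining a stable line keeps [W] stable. *)
Lemma stable_complement (As : seq 'M[F]_n) S U :
  {in As &, forall A B, A *m B = B *m A} ->
  {in As, forall A, diagonalizable A} -> {in As, forall A, stablemx S A} ->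
  exists W, [/\ {in As, forall A, stablemx W A}, (W <= S)%MS,
                (S <= U + W)%MS & (U :&: W)%MS = 0].
Proof.
move=> cAs dAs stS; have [s hs Ss] := common_eigenvectors cAs dAs stS.
suff [W [stW WS sW UW]] : exists W, [/\ {in As, forall A, stablemx W A}, (W <= S)%MS,
                (\sum_(v <- s) <<v>> <= U + W)%MS & (U :&: W)%MS = 0].
  by exists W; split=> //; apply: submx_trans Ss sW.
elim: s hs {Ss} => [|v s IH] hs.
  by exists 0; split; rewrite ?big_nil ?sub0mx ?capmx0 // => A _; rewrite mul0mx sub0mx.
have [|W [stW WS sW UW]] := IH; first by move=> w ws; apply: hs; rewrite inE ws orbT.
have [vS hv] := hs v (mem_head _ _).
have [vUW|nvUW] := boolP (v <= U + W)%MS.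
  by exists W; split=> //; rewrite big_cons addsmx_sub genmxE vUW.
exists (W + v)%MS; split.
- move=> A AAs; rewrite addsmxMr; apply: addsmxS; first exact: stW.
  by have [a ->] := hv A AAs; apply: scalemx_sub.
- by rewrite addsmx_sub WS.
- rewrite big_cons addsmx_sub genmxE addsmxA addsmxSr /=.
  by apply: submx_trans sW _; apply: addsmxSl.
apply/eqP/rowV0P => u; rewrite sub_capmx => /andP[uU /sub_addsmxP[[w1 w2] /= e]].
(* [w2] is the coefficient of [v] in [u]; were it nonzero, [v] would lie in [U + W]. *)
have [w20|w20] := eqVneq w2 0.
  apply/eqP; rewrite -submx0 -UW sub_capmx uU e w20 mul0mx addr0; exact: submxMl.
case/negP: nvUW.
have -> : v = (w2 0 0)^-1 *: (u - w1 *m W).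
  rewrite e addrC addKr (mx11_scalar w2) mul_scalar_mx mxE eqxx mulr1n.
  rewrite scalerA mulVf ?scale1r //; apply: contra w20 => /eqP w20.
  by apply/eqP; rewrite (mx11_scalar w2) w20 raddf0.
apply: scalemx_sub; rewrite addmx_sub ?eqmx_opp //.
  by apply: submx_trans uU (addsmxSl _ _).
by rewrite (submx_trans _ (addsmxSr _ _)) // submxMl.
Qed.
End DiagonalizableAlgebra.

(** * Complements of submodules for two commuting triples *)

Lemma stablemx_inv (F : fieldType) n (W A B : 'M[F]_n) :
  A *m B = 1%:M -> stablemx W A -> stablemx W B.
Proof.
move=> AB WA; have fA : row_free A by apply/row_freeP; exists B.
have WWA : (W <= W *m A)%MS by rewrite -(geq_leqif (mxrank_leqif_sup WA)) mxrankMfree.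
by apply: submx_trans (submxMr _ WWA) _; rewrite -mulmxA AB mulmx1.
Qed.

Lemma ker_stable (F : fieldType) n (b : F) (A B : 'M[F]_n) :
  B *m A = b *: (A *m B) -> stablemx (kermx A) B.
Proof.
move=> BA; apply/sub_kermxP.
by rewrite -mulmxA BA -scalemxAr mulmxA mulmx_ker mul0mx scaler0.
Qed.

Section Modules.
Variables (F : closedFieldType) (n : nat).
Implicit Types (U W S Z : 'M[F]_n).

(** [W] is the span of the [W0 *m y ^+ a]. The last two clauses carry stability under, and
    annihilation by, the operators of a second commuting triple from [W0] to [W]. *)
Lemma ladder_closure q c (x y k ki i ii : 'M[F]_n) W0 :
  qsl2 q c x y k ki i ii -> W0 *m x = 0 -> stablemx W0 k -> stablemx W0 i ->
  exists W, [/\ (W0 <= W)%MS, (W <= W0 + y)%MS, stablemx W x, stablemx W y &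
    [/\ forall (b : F) g, y *m g = b *: (g *m y) -> stablemx W0 g -> stablemx W g &
    forall g, y *m g = g *m y -> W0 *m g = 0 -> W *m g = 0]].
Proof.
move=> H W0x W0k W0i; have [N yN] := lower_nilpotent H.
pose W := (\sum_(a < N) W0 *m y ^+ a)%MS.
have supW a : (W0 *m y ^+ a <= W)%MS.
  have [aN|Na] := ltnP a N; first exact: (sumsmx_sup (Ordinal aN)).
  by rewrite -(subnKC Na) exprD yN mul0r mulmx0 sub0mx.
have subW g : (forall a, (W0 *m y ^+ a *m g <= W)%MS) -> stablemx W g.
  by move=> hg; rewrite sumsmxMr; apply/sumsmx_subP => a _; apply: hg.
have yg (b : F) g a : y *m g = b *: (g *m y) -> y ^+ a *m g = b ^+ a *: (g *m y ^+ a).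
  move=> e; elim: a => [|a IH]; first by rewrite expr0 scale1r mul1mx mulmx1.
  by rewrite exprSr -mulmxE -mulmxA e -scalemxAr (mulmxA (y ^+ a)) IH
    -scalemxAl scalerA -exprS mulmxA.
exists W; split.
- by have := supW 0; rewrite expr0 mulmx1.
- apply/sumsmx_subP => -[[|a] ?] _ /=; first by rewrite expr0 mulmx1 addsmxSl.
  by rewrite exprSr -mulmxE mulmxA (submx_trans _ (addsmxSr _ _)) // submxMl.
- apply: subW => -[|a]; first by rewrite expr0 mulmx1 W0x sub0mx.
  (* As [W0 *m x = 0], commuting [x] past [y ^+ a.+1] leaves only a ladder term, built from [k], [i]
     and [ki], which all preserve [W0]. *)
  have /esym/(canRL (addrK _)) e := comm_raise (qsl2_swap H) a.
  rewrite -mulmxA e mulmxBr mulmxA W0x mul0mx sub0r eqmx_opp mulmxA.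
  apply: submx_trans (submxMr _ _) (supW a).
  rewrite -scalemxAr scalemx_sub // mulmxBr addmx_sub ?eqmx_opp // -scalemxAr scalemx_sub //.
  by apply: stablemxM => //; apply: stablemx_inv (qsl2_kki H) W0k.
- by apply: subW => a; have := supW a.+1; rewrite exprSr -mulmxE mulmxA.
split=> [b g e W0g|g e W0g].
  apply: subW => a; rewrite -mulmxA (yg _ _ _ e) -scalemxAr scalemx_sub // mulmxA.
  exact: submx_trans (submxMr _ W0g) (supW a).
apply/eqP; rewrite -submx0 sumsmxMr; apply/sumsmx_subP => a _.
by rewrite -mulmxA (yg 1) ?scale1r // expr1n scale1r mulmxA W0g mul0mx.
Qed.

(** * Highest weight vectors of two commuting triples *)

Section TwoCopies.
Variables (q c : F) (x1 y1 k1 k1i x2 y2 k2 k2i i ii : 'M[F]_n).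
Hypotheses (H1 : qsl2 q c x1 y1 k1 k1i i ii) (H2 : qsl2 q c x2 y2 k2 k2i i ii).
Hypotheses (xx : x1 *m x2 = x2 *m x1) (xy : x1 *m y2 = y2 *m x1)
  (yx : y1 *m x2 = x2 *m y1) (yy : y1 *m y2 = y2 *m y1)
  (kx : k1 *m x2 = x2 *m k1) (ky : k1 *m y2 = y2 *m k1)
  (xk : x1 *m k2 = k2 *m x1) (yk : y1 *m k2 = k2 *m y1)
  (kk : k1 *m k2 = k2 *m k1).

Let Hw := (kermx x1 :&: kermx x2)%MS.

(** [nilpotent_generation] for [y2], then for [y1], reduces the claim to placing each [v] of
    [kermx x2] in [Z + kermx x2 *m y1]. *)
Lemma highest_weight_generation Z :
  stablemx Z y1 -> stablemx Z y2 -> (Hw <= Z)%MS -> (1%:M <= Z)%MS.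
Proof.
move=> Z1 Z2 HZ; have [[N1 y1N] [N2 y2N]] := (lower_nilpotent H1, lower_nilpotent H2).
apply: (nilpotent_generation y2N) => //; rewrite mul1mx.
apply: submx_trans (ker_raise_add_lower H2) _; apply: addsmxS => //.
apply: (nilpotent_generation y1N) => //; apply/row_subP => j.
set v := row j _; have vx2 : v *m x2 = 0 by rewrite -row_mul mulmx_ker row0.
have : (v <= kermx x1 + y1)%MS.
  by apply: submx_trans (ker_raise_add_lower H1); apply: submx1.
case/sub_addsmxP=> -[p w] /= ev; set p' := p *m kermx x1 in ev.
have p'x1 : p' *m x1 = 0 by rewrite -mulmxA mulmx_ker mulmx0.
have wxy : w *m x2 *m y1 = 0.
  apply: (lower_kernel H1).
  have -> : w *m x2 *m y1 = - (p' *m x2).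
    apply/eqP; rewrite -addr_eq0 addrC -[w *m x2 *m y1]mulmxA -yx mulmxA -mulmxDl -ev.
    by rewrite vx2.
  by rewrite mulNmx -mulmxA -xx mulmxA p'x1 mul0mx oppr0.
have p'x2 : p' *m x2 = 0.
  move: vx2; rewrite ev mulmxDl -(mulmxA w) yx mulmxA wxy addr0; exact.
rewrite ev; apply: addmx_sub_adds.
  by apply: submx_trans HZ; rewrite sub_capmx !sub_kermx p'x1 p'x2 eqxx.
(* [w] itself need not lie in [kermx x2], but its component [r'] does, and [w *m y1 = r' *m y1]
   because [s *m y2 *m y1] vanishes. *)
have : (w <= kermx x2 + y2)%MS.
  by apply: submx_trans (ker_raise_add_lower H2); apply: submx1.
case/sub_addsmxP=> -[r s] /= ew; set r' := r *m kermx x2 in ew.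
have r'x2 : r' *m x2 = 0 by rewrite -mulmxA mulmx_ker mulmx0.
have sy : s *m y1 *m y2 = 0.
  apply: (lower_kernel H2); rewrite -(mulmxA s) yy mulmxA.
  have -> : s *m y2 = w - r' by rewrite ew addrC addKr.
  by rewrite mulmxBl mulmxBl -(mulmxA w) -(mulmxA r') yx (mulmxA w)
    (mulmxA r') wxy r'x2 mul0mx subrr.
by rewrite ew mulmxDl -(mulmxA s) -yy mulmxA sy addr0 -mulmxA submxMl.
Qed.

(** Splitting [B] along [kermx x1 + y1] rewrites [V] as a multiple of [y1] plus [P' *m y2] with
    [P' *m x1 = 0]. Then [lower_kernel] kills the first term through [x1] and the second through
    [x2]. *)
Lemma highest_weight_cap_lower p (V A B : 'M[F]_(p, n)) :
  V = A *m y1 + B *m y2 -> V *m x1 = 0 -> V *m x2 = 0 -> V = 0.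
Proof.
move=> eV Vx1 Vx2.
have : (B <= kermx x1 + y1)%MS.
  by apply: submx_trans (ker_raise_add_lower H1); apply: submx1.
case/sub_addsmxP=> -[P R] /= eB; set P' := P *m kermx x1 in eB.
have P'x1 : P' *m x1 = 0 by rewrite -mulmxA mulmx_ker mulmx0.
have {}eV : V = (A + R *m y2) *m y1 + P' *m y2.
  by rewrite eV eB !mulmxDl -!mulmxA yy addrAC addrA.
have ARy : (A + R *m y2) *m y1 = 0.
  apply: (lower_kernel H1); move: Vx1; rewrite eV mulmxDl -(mulmxA P') -xy mulmxA.
  by rewrite P'x1 mul0mx addr0.
rewrite eV ARy add0r in Vx2 *; exact: lower_kernel H2 Vx2.
Qed.

Lemma submodule_complement U :
  diagonalizable k1 -> diagonalizable k2 -> diagonalizable i ->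
  stablemx U x1 -> stablemx U x2 -> stablemx U y1 -> stablemx U y2 ->
  stablemx U k1 -> stablemx U k2 -> stablemx U i ->
  exists W, [/\ stablemx W x1 /\ stablemx W x2, stablemx W y1 /\ stablemx W y2,
     [/\ stablemx W k1, stablemx W k2 & stablemx W i],
     (1%:M <= U + W)%MS & (U :&: W)%MS = 0].
Proof.
move=> dk1 dk2 di Ux1 Ux2 Uy1 Uy2 Uk1 Uk2 Ui.
have capS (S T g : 'M[F]_n) : stablemx S g -> stablemx T g -> stablemx (S :&: T)%MS g.
  move=> Sg Tg; rewrite sub_capmx; apply/andP; split.
    exact: submx_trans (submxMr _ (capmxSl _ _)) Sg.
  exact: submx_trans (submxMr _ (capmxSr _ _)) Tg.
have ker1 g : x1 *m g = g *m x1 -> stablemx (kermx x1) g.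
  by move=> e; apply: (@ker_stable _ _ 1); rewrite scale1r.
have ker2 g : x2 *m g = g *m x2 -> stablemx (kermx x2) g.
  by move=> e; apply: (@ker_stable _ _ 1); rewrite scale1r.
have qk x y k ki : qsl2 q c x y k ki i ii -> k *m x = (q ^+ 2)^-1 *: (x *m k).
  move=> H; rewrite (qsl2_xk H) scalerA mulVf ?scale1r // expf_neq0 //.
  by case: (qsl2_q H).
have [||A|W0 [W0s W0H HW0 UW0]] := @stable_complement F n [:: k1; k2; i] Hw (U :&: Hw)%MS.
- have i1 := qsl2_ik H1; have i2 := qsl2_ik H2.
  by move=> A B; rewrite !inE => /or3P[]/eqP-> /or3P[]/eqP->.
- by move=> A; rewrite !inE => /or3P[]/eqP->.
- rewrite !inE => /or3P[]/eqP->; apply: capS.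
  + exact: ker_stable (qk _ _ _ _ H1).
  + exact: ker2.
  + exact: ker1.
  + exact: ker_stable (qk _ _ _ _ H2).
  + by apply: ker1; rewrite (qsl2_ix H1).
  + by apply: ker2; rewrite (qsl2_ix H2).
have W0k1 : stablemx W0 k1 by apply: W0s; rewrite !inE eqxx.
have W0k2 : stablemx W0 k2 by apply: W0s; rewrite !inE eqxx orbT.
have W0i : stablemx W0 i by apply: W0s; rewrite !inE eqxx !orbT.
have W0x1 : W0 *m x1 = 0.
  by apply/sub_kermxP; apply: submx_trans W0H (capmxSl _ _).
have W0x2 : W0 *m x2 = 0.
  by apply/sub_kermxP; apply: submx_trans W0H (capmxSr _ _).
(* Closing under [y1] first keeps the space inside [kermx x2] by [kill1], as the closure under [y2]
   requires. *)
have [W1 [W01 W10 W1x1 W1y1 [st1 kill1]]] := ladder_closure H1 W0x1 W0k1 W0i.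
have W1x2 : W1 *m x2 = 0 by apply: kill1.
have W1k1 : stablemx W1 k1 by apply: st1 (qsl2_yk H1) W0k1.
have W1k2 : stablemx W1 k2 by apply: (st1 1); rewrite ?scale1r.
have W1i : stablemx W1 i by apply: (st1 1); rewrite ?scale1r ?(qsl2_iy H1).
have [W [W1W WW1 Wx2 Wy2 [st _]]] := ladder_closure H2 W1x2 W1k2 W1i.
have Wx1 : stablemx W x1 by apply: (st 1); rewrite ?scale1r.
have Wy1 : stablemx W y1 by apply: (st 1); rewrite ?scale1r.
exists W; split=> //.
- split; first by apply: (st 1); rewrite ?scale1r.
    by apply: st (qsl2_yk H2) W1k2.
  by apply: (st 1); rewrite ?scale1r ?(qsl2_iy H2).
- apply: highest_weight_generation; rewrite ?addsmxMr ?addsmxS //.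
  apply: submx_trans HW0 _; apply: addsmxS; first exact: capmxSl.
  exact: submx_trans W01 W1W.
(* By nilpotency of [x1] and [x2], it suffices that [U :&: W] contains no nonzero highest weight
   vector. *)
have [[N1 x1N] [N2 x2N]] := (raise_nilpotent H1, raise_nilpotent H2).
apply: (nilpotent_socle x1N); first exact: capS.
apply: (nilpotent_socle x2N); first by apply: (capS); [exact: capS|exact: ker1].
apply/eqP/rowV0P => v; rewrite !sub_capmx.
case/andP=> /andP[/andP[vU vW] /sub_kermxP vx1] /sub_kermxP vx2.
have : (v <= W0 + y1 + y2)%MS.
  apply: submx_trans vW _; apply: submx_trans WW1 _; exact: addsmxS.
case/sub_addsmxP=> -[v1 b] /= ev.
have : (v1 *m (W0 + y1)%MS <= W0 + y1)%MS by apply: submxMl.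
case/sub_addsmxP=> -[w a] /= ev1.
(* This difference is killed by [x1] and [x2] and lies in the sum of the images of [y1] and [y2];
   hence [v] lies in [W0]. *)
have v0 : v - w *m W0 = 0.
  apply: (@highest_weight_cap_lower _ _ a b).
  - by rewrite ev ev1 addrAC [w *m W0 + _]addrC addrK addrC.
  - by rewrite mulmxBl vx1 -mulmxA W0x1 mulmx0 subrr.
  - by rewrite mulmxBl vx2 -mulmxA W0x2 mulmx0 subrr.
apply/eqP; rewrite -submx0 -UW0 !sub_capmx !sub_kermx vx1 vx2 vU eqxx /=.
by move/eqP: v0; rewrite subr_eq0 => /eqP->; apply: submxMl.
Qed.
End TwoCopies.
End Modules.

(** * Modules over W_q *)

Section WqModule.
Variables (F : closedFieldType) (q : F) (n : nat) (V : Wq_module q n).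
Hypothesis hq : not_root_of_unity q.

Let q0 : q != 0. Proof. by case: hq. Qed.

Lemma qcomm_eq0 (A B : 'M[F]_n) : qcomm q A B = 0 -> B *m A = q ^+ 2 *: (A *m B).
Proof.
move/eqP; rewrite subr_eq0 => /eqP/(congr1 (GRing.scale q)).
by rewrite !scalerA divff // scale1r -expr2.
Qed.

Lemma qcomm_eq0V (A B : 'M[F]_n) : qcomm q A B = 0 -> A *m B = q^-1 ^+ 2 *: (B *m A).
Proof. by move/qcomm_eq0->; rewrite scalerA -exprMn mulVf // expr1n scale1r. Qed.

Lemma qsubV_neq0 : q - q^-1 != 0.
Proof.
rewrite subr_eq0; apply/negP => /eqP /(congr1 ( *%R q)); rewrite divff // => /eqP.
by apply/negP; case: hq => _ /(_ 2 isT); rewrite expr2.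
Qed.

Lemma tr_comm (A B : 'M[F]_n) : A *m B = B *m A -> A^T *m B^T = B^T *m A^T.
Proof. by move/(congr1 trmx); rewrite !trmx_mul. Qed.

Lemma tr_mul1 (A B : 'M[F]_n) : A *m B = 1%:M -> B^T *m A^T = 1%:M.
Proof. by move/(congr1 trmx); rewrite trmx_mul trmx1. Qed.

(** Transposition reverses products, so the commutator of [wE1] and [wF1] becomes
    [y *m x - x *m y]. *)
Lemma Wq_qsl2_1 : qsl2 q (q - q^-1)^-1 (wE1 V)^T (wF1 V)^T (wK1 V)^T (wK1i V)^T
  (wI V)^T (wIi V)^T.
Proof.
split=> //.
- by rewrite invr_eq0 qsubV_neq0.
- exact/tr_mul1/wK1iK1.
- exact/tr_mul1/wIiI.
- exact/tr_comm/wI_E1.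
- exact/tr_comm/wI_F1.
- exact/tr_comm/wI_K1.
- by rewrite -!trmx_mul (qcomm_eq0 (wE1_K1 V)) linearZ.
- by rewrite -!trmx_mul (qcomm_eq0V (wK1_F1 V)) linearZ.
rewrite -!trmx_mul -(wI_K1i V) -linearB /= wE1_F1 linearZ /= linearB /=.
by rewrite trmx_mul.
Qed.

(* With k = I K2 the second triple satisfies the same relations as the first. *)
Lemma Wq_qsl2_2 : qsl2 q (q - q^-1)^-1 (wE2 V)^T (wF2 V)^T
  (wI V *m wK2 V)^T (wK2i V *m wIi V)^T (wI V)^T (wIi V)^T.
Proof.
split=> //.
- by rewrite invr_eq0 qsubV_neq0.
- apply: tr_mul1; rewrite -mulmxA (mulmxA (wIi V)) wIiI mul1mx; exact: wK2iK2.
- exact/tr_mul1/wIiI.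
- exact/tr_comm/wI_E2.
- exact/tr_comm/wI_F2.
- by apply: tr_comm; rewrite -mulmxA -wI_K2.
- rewrite -!trmx_mul -mulmxA (qcomm_eq0 (wE2_K2 V)) -scalemxAr linearZ /=.
  by rewrite !mulmxA wI_E2.
- rewrite -!trmx_mul -mulmxA (qcomm_eq0V (wK2_F2 V)) -scalemxAr linearZ /=.
  by rewrite !mulmxA wI_F2.
rewrite -!trmx_mul -linearB /= wE2_F2 linearZ /= linearB /=.
by rewrite -(mulmxA (wK2i V)) wIiI mulmx1.
Qed.

Lemma stablemx_Wq_gens (U : 'M[F]_n) : Wq_submodule V U ->
  [/\ stablemx U (wE1 V)^T /\ stablemx U (wE2 V)^T,
      stablemx U (wF1 V)^T /\ stablemx U (wF2 V)^T &
      [/\ stablemx U (wK1 V)^T, stablemx U (wI V *m wK2 V)^T & stablemx U (wI V)^T]].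
Proof.
move=> sU; have g A : A \in Wq_gens V -> stablemx U A^T := sU A.
by split; [split|split|split]; rewrite ?trmx_mul ?stablemxM //; apply: g;
   rewrite !inE eqxx ?orbT.
Qed.

Lemma Wq_submodule_stablemx (U : 'M[F]_n) :
  stablemx U (wE1 V)^T /\ stablemx U (wE2 V)^T ->
  stablemx U (wF1 V)^T /\ stablemx U (wF2 V)^T ->
  [/\ stablemx U (wK1 V)^T, stablemx U (wI V *m wK2 V)^T & stablemx U (wI V)^T] ->
  Wq_submodule V U.
Proof.
move=> [e1 e2] [f1 f2] [k1 k2 i].
have ii : stablemx U (wIi V)^T by apply: stablemx_inv i; apply/tr_mul1/wIiI.
have k : stablemx U (wK2 V)^T.
  have -> : (wK2 V)^T = (wI V *m wK2 V)^T *m (wIi V)^T.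
    by rewrite -trmx_mul mulmxA wIiI mul1mx.
  exact: stablemxM.
move=> A; rewrite !inE => /or4P[||/eqP->|] //; try by move=> /eqP->.
case/or4P=> [/eqP->|/eqP->|/eqP->|] //.
  by apply: stablemx_inv k1; apply/tr_mul1/wK1iK1.
case/or4P=> [/eqP->|/eqP->|/eqP->|/eqP->] //.
by apply: stablemx_inv k; apply/tr_mul1/wK2iK2.
Qed.

Lemma Wq_completely_reducible_diagonalizable :
  Wq_completely_reducible V -> diagonalizable (wI V).
Proof.
move=> cr; apply: (iffLR (diagonalizable_trmx _)); apply/diagonalizable_eigsum.
have [|W sW [sum /mxdirect_addsP dir]] := cr (eigsum (wI V)^T).
  move=> A Ag.
  apply: (@stablemx_eigsum _ _ 1); rewrite scale1r; apply/esym.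
  apply: tr_comm; move: Ag; rewrite !inE.
  case/or4P=> [/eqP->|/eqP->|/eqP->|]; rewrite ?wI_E1 ?wI_E2 ?wI_F1 //.
  case/or4P=> [/eqP->|/eqP->|/eqP->|]; rewrite ?wI_F2 ?wI_K1 ?wI_K1i //.
  by case/or4P=> [/eqP->|/eqP->|/eqP->|/eqP->]; rewrite ?wI_K2 ?wI_K2i ?wIIi ?wIiI.
suff W0 : W = 0 by move: sum; rewrite W0 => <-; rewrite addsmx0_id.
apply: (@eq0_cap_eigenspace _ _ _ _ (wI V)^T) => [|a].
  by case: (stablemx_Wq_gens sW) => _ _ [].
apply/eqP; rewrite -submx0 -dir sub_capmx capmxSl andbT.
exact: submx_trans (capmxSr _ _) (sub_eigsum _ a).
Qed.

(** * Transfer of diagonalizability between I, K1 and K2 *)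

Lemma Wq_weight1_diagonalizable : diagonalizable (wIi V *m (wK1 V *m wK1 V)).
Proof.
apply: (iffLR (diagonalizable_trmx _)); rewrite !trmx_mul.
exact: weight_diagonalizable Wq_qsl2_1.
Qed.

Lemma Wq_weight2_diagonalizable : diagonalizable (wI V *m (wK2 V *m wK2 V)).
Proof.
apply: (iffLR (diagonalizable_trmx _)).
have := weight_diagonalizable Wq_qsl2_2; rewrite -!trmx_mul.
by rewrite !mulmxA wIiI mul1mx -wI_K2.
Qed.

Lemma wIi_K1 : wIi V *m wK1 V = wK1 V *m wIi V.
Proof. exact/esym/(comm_mxV (wIIi V))/esym/wI_K1. Qed.

Lemma wIi_K2 : wIi V *m wK2 V = wK2 V *m wIi V.
Proof. exact/esym/(comm_mxV (wIIi V))/esym/wI_K2. Qed.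

(** [I^-1] is the product of the commuting diagonalizable matrices [I^-1 K1^2] and [K1^-2]. *)
Lemma diagonalizable_I_of_K1 : diagonalizable (wK1 V) -> diagonalizable (wI V).
Proof.
move=> dK; apply: (@diagonalizable_inv _ _ (wIi V)); first exact: wIiI.
have dKi := diagonalizable_inv (wK1K1i V) dK.
have dKi2 := diagonalizable_mulmx erefl dKi dKi.
have KK : wK1 V *m wK1 V *m (wK1i V *m wK1i V) = 1%:M.
  by rewrite mulmxA -(mulmxA (wK1 V)) wK1K1i mulmx1 wK1K1i.
have -> : wIi V = wIi V *m (wK1 V *m wK1 V) *m (wK1i V *m wK1i V).
  by rewrite -mulmxA KK mulmx1.
apply: diagonalizable_mulmx Wq_weight1_diagonalizable dKi2.
rewrite -[LHS]mulmxA KK mulmx1 [RHS]mulmxA.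
have -> : wK1i V *m wK1i V *m wIi V = wIi V *m (wK1i V *m wK1i V).
  have cIi : wIi V *m wK1i V = wK1i V *m wIi V.
    by apply: (comm_mxV (wK1K1i V)); apply: wIi_K1.
  by rewrite mulmxA cIi -!mulmxA cIi.
by rewrite -mulmxA (mulmx1C KK) mulmx1.
Qed.

Lemma diagonalizable_I_of_K2 : diagonalizable (wK2 V) -> diagonalizable (wI V).
Proof.
move=> dK.
have dKi := diagonalizable_inv (wK2K2i V) dK.
have dKi2 := diagonalizable_mulmx erefl dKi dKi.
have KK : wK2 V *m wK2 V *m (wK2i V *m wK2i V) = 1%:M.
  by rewrite mulmxA -(mulmxA (wK2 V)) wK2K2i mulmx1 wK2K2i.
have -> : wI V = wI V *m (wK2 V *m wK2 V) *m (wK2i V *m wK2i V).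
  by rewrite -mulmxA KK mulmx1.
apply: diagonalizable_mulmx Wq_weight2_diagonalizable dKi2.
rewrite -[LHS]mulmxA KK mulmx1 [RHS]mulmxA.
have -> : wK2i V *m wK2i V *m wI V = wI V *m (wK2i V *m wK2i V).
  by rewrite mulmxA wI_K2i -!mulmxA wI_K2i.
by rewrite -mulmxA (mulmx1C KK) mulmx1.
Qed.

Hypothesis two_neq0 : (2 : F) != 0.

(** [K1^2] is the product of [I] and [I^-1 K1^2], so [diagonalizable_sqrt] applies to the invertible
    [K1]. *)
Lemma diagonalizable_K1_of_I : diagonalizable (wI V) -> diagonalizable (wK1 V).
Proof.
move=> dI; apply: (diagonalizable_sqrt two_neq0 (wK1K1i V)).
have -> : wK1 V *m wK1 V = wI V *m (wIi V *m (wK1 V *m wK1 V)).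
  by rewrite mulmxA wIIi mul1mx.
apply: diagonalizable_mulmx dI Wq_weight1_diagonalizable.
rewrite (mulmxA (wI V)) wIIi mul1mx -!mulmxA -wI_K1 (mulmxA (wK1 V)) -wI_K1 !mulmxA wIiI.
by rewrite mul1mx.
Qed.

Lemma diagonalizable_K2_of_I : diagonalizable (wI V) -> diagonalizable (wK2 V).
Proof.
move=> dI; apply: (diagonalizable_sqrt two_neq0 (wK2K2i V)).
have dIi := diagonalizable_inv (wIIi V) dI.
have -> : wK2 V *m wK2 V = wIi V *m (wI V *m (wK2 V *m wK2 V)).
  by rewrite mulmxA wIiI mul1mx.
apply: diagonalizable_mulmx dIi Wq_weight2_diagonalizable.
rewrite (mulmxA (wIi V)) wIiI mul1mx -!mulmxA -wIi_K2 (mulmxA (wK2 V)) -wIi_K2 !mulmxA wIIi.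
by rewrite mul1mx.
Qed.

Lemma diagonalizable_completely_reducible :
  diagonalizable (wI V) -> Wq_completely_reducible V.
Proof.
move=> dI U sU.
have [[e1 e2] [f1 f2] [k1 k2 i]] := stablemx_Wq_gens sU.
have dK1 := diagonalizable_K1_of_I dI.
have dIK2 : diagonalizable (wI V *m wK2 V).
  by apply: (diagonalizable_mulmx (wI_K2 V) dI); apply: diagonalizable_K2_of_I.
have cI2 A : wI V *m A = A *m wI V -> A *m wK2 V = wK2 V *m A ->
    A *m (wI V *m wK2 V) = wI V *m wK2 V *m A.
  by move=> cI cK; rewrite mulmxA -cI -!mulmxA cK.
have [W [We Wf Wk UW1 UW0]] : exists W : 'M[F]_n,
    [/\ stablemx W (wE1 V)^T /\ stablemx W (wE2 V)^T,
     stablemx W (wF1 V)^T /\ stablemx W (wF2 V)^T,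
     [/\ stablemx W (wK1 V)^T, stablemx W (wI V *m wK2 V)^T & stablemx W (wI V)^T],
     (1%:M <= U + W)%MS & (U :&: W)%MS = 0].
  apply: (submodule_complement Wq_qsl2_1 Wq_qsl2_2) => //;
    try exact: (iffRL (diagonalizable_trmx _)).
  - exact/tr_comm/wE1_E2.
  - exact/tr_comm/wE1_F2.
  - exact/tr_comm/wF1_E2.
  - exact/tr_comm/wF1_F2.
  - exact/tr_comm/wK1_E2.
  - exact/tr_comm/wK1_F2.
  - by apply/tr_comm/cI2; rewrite ?wI_E1 // wK2_E1.
  - by apply/tr_comm/cI2; rewrite ?wI_F1 // wK2_F1.
  - by apply/tr_comm/cI2; rewrite ?wI_K1 // wK1_K2.
exists W; first exact: Wq_submodule_stablemx.
split; last by apply/mxdirect_addsP.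
by apply/eqmxP; rewrite submx1.
Qed.
End WqModule.

Theorem mainTheorem9 (R : realType) (q : R[i]) (hq : not_root_of_unity q)
  (n : nat) (V : Wq_module q n) :
  [/\ (Wq_completely_reducible V <-> diagonalizable (wK1 V)),
      (Wq_completely_reducible V <-> diagonalizable (wK2 V)) &
      (Wq_completely_reducible V <-> diagonalizable (wI V))].
Proof.
have two0 : (2 : R[i]) != 0 by rewrite pnatr_eq0.
have crI := Wq_completely_reducible_diagonalizable (V := V).
have Icr := diagonalizable_completely_reducible hq two0 (V := V).
split; split.
- by move/crI; apply: diagonalizable_K1_of_I.
- by move=> dK; apply/Icr/(diagonalizable_I_of_K1 hq).
- by move/crI; apply: diagonalizable_K2_of_I.
- by move=> dK; apply/Icr/(diagonalizable_I_of_K2 hq).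
- exact: crI.
- exact: Icr.
Qed.
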